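(* A subtractive Dedekind semidomain with only finitely many prime ideals is a principal ideal semidomain (PISD), i.e. each of its ideals is principal.
   Context: A semiring is $(S,+,\cdot,0,1)$ where $(S,+,0)$ and $(S,\cdot,1)$ are commutative monoids, $1\neq 0$, multiplication distributes over addition, and $a\cdot 0=0$ for all $a$. A semidomain is a semiring $S$ in which $ab=ac$ with $a\neq 0$ implies $b=c$. Its semifield of fractions $K=F(S)$ is the localization of $S$ at $S-\{0\}$. An ideal of $S$ is a nonempty subset closed under addition and under multiplication by elements of $S$; it is principal if it is generated by a single element. An ideal $I$ is subtractive if $a+b\in I$ and $a\in I$ imply $b\in I$ for all $a,b\in S$; a semiring is subtractive if each of its ideals is subtractive. A prime ideal is a proper ideal $\mathfrak{p}$ such that $ab\in\mathfrak{p}$ implies $a\in\mathfrak{p}$ or $b\in\mathfrak{p}$. A fractional ideal of $S$ is a nonempty subset $A\subseteq K$ closed under addition and under multiplication by elements of $S$ such that $dA\subseteq S$ for some nonzero $d\in S$. The product of fractional ideals $A,B$ is $AB=\{\sum_{i=1}^n a_ib_i: a_i\in A, b_i\in B\}$, and $A$ is invertible if $AB=S$ for some fractional ideal $B$. A Dedekind semidomain is a semidomain in which each nonzero fractional ideal is invertible. *)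

(* Defs.v *)
From HB Require Import structures.
From mathcomp Require Import all_boot all_order all_algebra ring.
From mathcomp Require Import boolp classical_sets functions cardinality.

Set Implicit Arguments.
Unset Strict Implicit.
Unset Printing Implicit Defensive.

Import GRing.Theory.
Local Open Scope classical_set_scope.
Local Open Scope ring_scope.

HB.mixin Record ComNzSemiRing_isSemidomain S of GRing.ComNzSemiRing S := {
  semidomain_mulI : forall a b c : S, a != 0 -> a * b = a * c -> b = c
}.

#[short(type="semidomainType")]
HB.structure Definition Semidomain :=
  {S of GRing.ComNzSemiRing S & ComNzSemiRing_isSemidomain S}.

Section SemidomainTheory.
Variable S : semidomainType.

Lemma semidomain_mulf_neq0 (a b : S) : a != 0 -> b != 0 -> a * b != 0.
Proof.
move=> a0; apply: contra_neq => ab0.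
by apply: (semidomain_mulI _ _ _ a0); rewrite ab0 mulr0.
Qed.

End SemidomainTheory.

(* The localization of S at S - {0}: mathcomp's {fraction _} is restricted to
   integral domains (which have opposites), so it is rebuilt here. By
   cancellation, the relation (a, s) ~ (b, t) of the localization, i.e.,
   u * (a * t) = u * (b * s) for some u != 0, is a * t = b * s. *)
Module SemiFraction.
Section SemiFraction.
Variable S : semidomainType.

Definition ratio := {p : S * S | p.2 != 0}.
HB.instance Definition _ := SubType.on ratio.
HB.instance Definition _ := Choice.on ratio.

Definition num (x : ratio) : S := (val x).1.
Definition den (x : ratio) : S := (val x).2.

Lemma den_neq0 (x : ratio) : den x != 0. Proof. exact: (valP x). Qed.

Definition mk (a s : S) (s0 : s != 0) : ratio := exist _ (a, s) s0.

Definition equivf (x y : ratio) : bool := num x * den y == num y * den x.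

Lemma equivf_refl : reflexive equivf. Proof. by move=> x; apply/eqP. Qed.

Lemma equivf_sym : symmetric equivf.
Proof. by move=> x y; rewrite /equivf eq_sym. Qed.

Lemma equivf_trans : transitive equivf.
Proof.
move=> y x z /eqP xy /eqP yz; apply/eqP.
apply: (semidomain_mulI _ _ _ (den_neq0 y)).
by rewrite mulrA [den y * _]mulrC xy mulrAC yz mulrAC mulrC.
Qed.

Canonical equivf_equiv := EquivRel equivf equivf_refl equivf_sym equivf_trans.

Definition type := {eq_quot equivf}%qT.
HB.instance Definition _ : EqQuotient _ equivf type := EqQuotient.on type.
HB.instance Definition _ := Choice.on type.

Lemma equivfP (x y : ratio) :
  (\pi_type x = \pi_type y)%qT <-> num x * den y = num y * den x.
Proof. by split=> [/eqmodP /eqP | /eqP xy] //; apply/eqmodP. Qed.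

Lemma repr_pi (x : ratio) :
  num (repr (\pi_type x)%qT) * den x = num x * den (repr (\pi_type x)%qT).
Proof. by apply/equivfP; rewrite reprK. Qed.

Definition addf (x y : ratio) : ratio :=
  mk (num x * den y + num y * den x)
     (semidomain_mulf_neq0 (den_neq0 x) (den_neq0 y)).
Definition mulf (x y : ratio) : ratio :=
  mk (num x * num y) (semidomain_mulf_neq0 (den_neq0 x) (den_neq0 y)).

Let numE :=
  ((fun (a s : S) (s0 : s != 0) => erefl : num (mk a s0) = a),
   (fun x y => erefl : num (addf x y) = num x * den y + num y * den x),
   (fun x y => erefl : num (mulf x y) = num x * num y)).
Let denE :=
  ((fun (a s : S) (s0 : s != 0) => erefl : den (mk a s0) = s),
   (fun x y => erefl : den (addf x y) = den x * den y),
   (fun x y => erefl : den (mulf x y) = den x * den y)).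

Definition frac (a s : S) (s0 : s != 0) : type := (\pi_type (mk a s0))%qT.
Definition add (x y : type) : type := (\pi_type (addf (repr x) (repr y)))%qT.
Definition mul (x y : type) : type := (\pi_type (mulf (repr x) (repr y)))%qT.
Definition zero : type := frac 0 (oner_neq0 S).
Definition one : type := frac 1 (oner_neq0 S).

Lemma add_pi (x y : ratio) :
  add (\pi_type x)%qT (\pi_type y)%qT = (\pi_type (addf x y))%qT.
Proof.
apply/equivfP.
rewrite !(numE, denE); have := repr_pi x; have := repr_pi y.
move: (repr _) => y'; move: (repr _) => x' yE xE.
rewrite [LHS](_ : _ = (num x' * den x) * (den y' * den y) +
                      (num y' * den y) * (den x' * den x)); last by ring.
by rewrite xE yE; ring.
Qed.

Lemma mul_pi (x y : ratio) :
  mul (\pi_type x)%qT (\pi_type y)%qT = (\pi_type (mulf x y))%qT.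
Proof.
apply/equivfP.
rewrite !(numE, denE); have := repr_pi x; have := repr_pi y.
move: (repr _) => y'; move: (repr _) => x' yE xE.
rewrite [LHS](_ : _ = (num x' * den x) * (num y' * den y)); last by ring.
by rewrite xE yE; ring.
Qed.

Let addA : associative add.
Proof.
elim/quotW=> x; elim/quotW=> y; elim/quotW=> z.
rewrite (add_pi y z) (add_pi x y) !add_pi.
by apply/equivfP; rewrite !(numE, denE); ring.
Qed.

Let addC : commutative add.
Proof.
elim/quotW=> x; elim/quotW=> y; rewrite !add_pi.
by apply/equivfP; rewrite !(numE, denE); ring.
Qed.

Let add0 : left_id zero add.
Proof.
elim/quotW=> x; rewrite add_pi.
by apply/equivfP; rewrite !(numE, denE); ring.
Qed.

Let mulA : associative mul.
Proof.
elim/quotW=> x; elim/quotW=> y; elim/quotW=> z.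
rewrite (mul_pi y z) (mul_pi x y) !mul_pi.
by apply/equivfP; rewrite !(numE, denE); ring.
Qed.

Let mulC : commutative mul.
Proof.
elim/quotW=> x; elim/quotW=> y; rewrite !mul_pi.
by apply/equivfP; rewrite !(numE, denE); ring.
Qed.

Let mul1 : left_id one mul.
Proof.
elim/quotW=> x; rewrite mul_pi.
by apply/equivfP; rewrite !(numE, denE); ring.
Qed.

Let mulDl : left_distributive mul add.
Proof.
elim/quotW=> x; elim/quotW=> y; elim/quotW=> z.
rewrite (add_pi x y) (mul_pi x z).
rewrite (mul_pi y z) mul_pi add_pi.
by apply/equivfP; rewrite !(numE, denE); ring.
Qed.

Let mul0 : left_zero zero mul.
Proof.
elim/quotW=> x; rewrite mul_pi.
by apply/equivfP; rewrite !(numE, denE); ring.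
Qed.

Let one_neq0 : one != zero.
Proof.
apply/eqP => /equivfP; rewrite !(numE, denE) mulr1 mul0r.
exact/eqP/oner_neq0.
Qed.

HB.instance Definition _ := GRing.isNmodule.Build type addA addC add0.
HB.instance Definition _ := GRing.Nmodule_isComNzSemiRing.Build type
  mulA mulC mul1 mulDl mul0 one_neq0.

End SemiFraction.
End SemiFraction.
HB.export SemiFraction.

Notation "{ 'semifraction' S }" := (SemiFraction.type S)
  (format "{ 'semifraction'  S }") : type_scope.

Section SemiFractionTheory.
Variable S : semidomainType.
Implicit Types (a b s t : S).

Definition frac a s (s0 : s != 0) : {semifraction S} := SemiFraction.frac a s0.

Definition tofrac a : {semifraction S} := frac a (oner_neq0 S).

Lemma fracP (x : {semifraction S}) :
  exists a s (s0 : s != 0), x = frac a s0.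
Proof. by elim/quotW: x => -[[a s] s0]; exists a, s, s0. Qed.

Lemma frac_eq a b s t (s0 : s != 0) (t0 : t != 0) :
  frac a s0 = frac b t0 <-> a * t = b * s.
Proof. exact: SemiFraction.equivfP. Qed.

Lemma add_frac a b s t (s0 : s != 0) (t0 : t != 0) :
  frac a s0 + frac b t0 = frac (a * t + b * s) (semidomain_mulf_neq0 s0 t0).
Proof. by rewrite [LHS]SemiFraction.add_pi; apply/SemiFraction.equivfP. Qed.

Lemma mul_frac a b s t (s0 : s != 0) (t0 : t != 0) :
  frac a s0 * frac b t0 = frac (a * b) (semidomain_mulf_neq0 s0 t0).
Proof. by rewrite [LHS]SemiFraction.mul_pi; apply/SemiFraction.equivfP. Qed.

Lemma tofrac_inj : injective tofrac.
Proof. by move=> a b /frac_eq; rewrite !mulr1. Qed.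

Let tofrac0D : nmod_morphism tofrac.
Proof.
by split=> // a b; rewrite add_frac; apply/frac_eq; rewrite !mulr1.
Qed.

Let tofrac1M : monoid_morphism tofrac.
Proof. by split=> // a b; rewrite mul_frac; apply/frac_eq; rewrite !mulr1. Qed.

HB.instance Definition _ :=
  GRing.isNmodMorphism.Build S {semifraction S} tofrac tofrac0D.
HB.instance Definition _ :=
  GRing.isMonoidMorphism.Build S {semifraction S} tofrac tofrac1M.

Lemma semifraction_invP (x : {semifraction S}) :
  x != 0 -> exists y : {semifraction S}, x * y = 1.
Proof.
have [a [s [s0 ->]]] := fracP x => as0.
have a0 : a != 0.
  by apply: contra_neq as0 => ->; apply/frac_eq; rewrite !mul0r.
exists (frac s a0); rewrite mul_frac; apply/frac_eq.
by rewrite mulr1 mul1r mulrC.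
Qed.

End SemiFractionTheory.

Section Ideals.
Variable S : semidomainType.
Implicit Types I P : set S.
Local Notation K := {semifraction S}.
Implicit Types A B : set K.

Definition ideal I : Prop :=
  [/\ I !=set0,
      forall a b, I a -> I b -> I (a + b)
    & forall s a, I a -> I (s * a)].

Definition principal I : Prop := exists a : S, I = smallest ideal [set a].

Definition subtractive_ideal I : Prop :=
  forall a b, I (a + b) -> I a -> I b.

Definition prime_ideal P : Prop :=
  [/\ ideal P, P <> setT & forall a b, P (a * b) -> P a \/ P b].

Definition fractional_ideal A : Prop :=
  [/\ A !=set0,
      forall x y, A x -> A y -> A (x + y),
      forall s x, A x -> A (tofrac s * x)
    & exists2 d : S, d != 0
        & [set tofrac d * x | x in A] `<=` range (@tofrac S)].

Definition fractional_mul A B : set K :=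
  [set x | exists n (a b : 'I_n -> K),
     [/\ forall i, A (a i), forall i, B (b i) & x = \sum_(i < n) a i * b i]].

Definition invertible A : Prop :=
  exists B, fractional_ideal B /\ fractional_mul A B = range (@tofrac S).

End Ideals.

Definition subtractive_semiring (S : semidomainType) : Prop :=
  forall I : set S, ideal I -> subtractive_ideal I.

Definition dedekind_semidomain (S : semidomainType) : Prop :=
  forall A : set {semifraction S},
    fractional_ideal A -> A <> [set 0] -> invertible A.

Definition principal_ideal_semidomain (S : semidomainType) : Prop :=
  forall I : set S, ideal I -> principal I.

Lemma smallest_ideal1 (S : semidomainType) (a : S) :
  smallest (@ideal S) [set a] = [set s * a | s in setT].
Proof.
apply/seteqP; split=> [x|_ [s _ <-] I [[_ _ IM] aI]]; last exact/IM/aI.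
apply; split; last by move=> _ ->; exists 1; rewrite ?mul1r.
split; first by exists (1 * a); exists 1.
  by move=> _ _ [s _ <-] [t _ <-]; exists (s + t); rewrite ?mulrDl.
by move=> s _ [t _ <-]; exists (s * t); rewrite ?mulrA.
Qed.

(* Main.v *)
(* Let [I] be a nonzero ideal with inverse [J].  By induction on a list of
   maximal ideals, some [v] in [J] satisfies that [v I] is contained in none of
   them: if [v] works for [s] but [v I] lies in [m], pick [a] in [I], [b] in [J]
   with [a b] outside [m], and [u] outside [m] but in every member of [s]; then
   [v + u b] works for [m :: s], because the ideals of [S] are subtractive.
   Applied to the finitely many maximal ideals, this makes [v I] equal to [S],
   so [1 = v a] with [a] in [I], and [x = (x v) a] for every [x] in [I]. *)
Require Import Defs.
From HB Require Import structures.
From mathcomp Require Import all_boot all_order all_algebra.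
From mathcomp Require Import boolp classical_sets functions cardinality.

Set Implicit Arguments.
Unset Strict Implicit.
Unset Printing Implicit Defensive.

Local Open Scope classical_set_scope.
Local Open Scope ring_scope.

Import GRing.Theory.

(* [all_algebra] shadows this name by the embedding into [{fraction _}]. *)
Local Notation tofrac := Defs.tofrac.

(** Properness is put as [~ M 1], which for an ideal amounts to [M <> setT] and visibly survives
    unions of chains. *)
Definition maximal_ideal (S : semidomainType) (M : set S) : Prop :=
  [/\ ideal M, ~ M 1
    & forall J : set S, ideal J -> M `<=` J -> ~ J 1 -> J `<=` M].

Section IdealTheory.
Variable S : semidomainType.
Implicit Types (I J M : set S) (a b u x : S).

Lemma ideal_neq0 I : ideal I -> I !=set0.
Proof. by case. Qed.

Lemma idealD I a b : ideal I -> I a -> I b -> I (a + b).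
Proof. by case=> _ + _; apply. Qed.

Lemma idealMl I s a : ideal I -> I a -> I (s * a).
Proof. by case=> _ _; apply. Qed.

Lemma idealMr I s a : ideal I -> I a -> I (a * s).
Proof. by move=> idI Ia; rewrite mulrC; apply: idealMl. Qed.

Lemma ideal0 I : ideal I -> I 0.
Proof.
by move=> idI; have [a Ia] := ideal_neq0 idI; rewrite -(mul0r a); apply: idealMl.
Qed.

Lemma ideal_sum I n (c : 'I_n -> S) :
  ideal I -> (forall i, I (c i)) -> I (\sum_(i < n) c i).
Proof.
move=> idI Ic; apply: (big_ind I) => //; first exact: ideal0.
by move=> a b; apply: idealD.
Qed.

(** If [a] is outside [M], maximality forces [M + a S] to contain 1. Writing [1 = x + a * s] with
    [x] in [M] gives [b = x * b + a * b * s], which lies in [M]. *)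
Lemma maximal_ideal_prime M : maximal_ideal M -> prime_ideal M.
Proof.
move=> [idM M1 maxM]; split=> // [MT|a b Mab]; first by apply: M1; rewrite MT.
have [Ma|Ma] := pselect (M a); [by left | right].
pose J := [set z | exists x s, M x /\ z = x + a * s].
have idJ : ideal J.
  split.
  - by exists (0 + a * 0), 0, 0; split=> //; apply: ideal0.
  - move=> _ _ [x [s [Mx ->]]] [y [t [My ->]]].
    by exists (x + y), (s + t); rewrite mulrDr addrACA; split=> //; apply: idealD.
  - move=> r _ [x [s [Mx ->]]].
    by exists (r * x), (r * s); rewrite mulrDr mulrCA; split=> //; apply: idealMl.
have [[x [s [Mx x1]]]|J1] := pselect (J 1).
  rewrite -(mul1r b) x1 mulrDl mulrAC; apply: idealD => //; exact: idealMr.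
have MJ : M `<=` J by move=> x Mx; exists x, 0; rewrite mulr0 addr0.
case: Ma; apply: (maxM J) => //.
by exists 0, 1; rewrite mulr1 add0r; split=> //; apply: ideal0.
Qed.

Lemma exists_maximal_ideal I :
  ideal I -> ~ I 1 -> exists2 M, maximal_ideal M & I `<=` M.
Proof.
move=> idI I1.
(* Taking the union with [I] keeps the empty chain from being a special case. *)
pose P := [set X : set S | ideal (I `|` X) /\ ~ (I `|` X) 1].
have chainP F : F `<=` P -> total_on F subset -> P (\bigcup_(X in F) X).
  move=> FP totF; split; last first.
    by move=> [//|[X FX X1]]; have [_] := FP X FX; apply; right.
  have lift X x : F X -> (I `|` X) x -> (I `|` \bigcup_(X in F) X) x.
    by move=> FX [Ix|Xx]; [left | right; exists X].
  split.
  - by have [x Ix] := ideal_neq0 idI; exists x; left.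
  (* Two summands from members of the chain both lie in the larger member. *)
  - move=> a b [Ia|[X FX Xa]] [Ib|[Y FY Yb]].
    + by left; apply: idealD.
    + by apply: (lift Y) => //; apply: idealD (FP Y FY).1 _ _; [left|right].
    + by apply: (lift X) => //; apply: idealD (FP X FX).1 _ _; [right|left].
    + have [XY|YX] := totF X Y FX FY.
        apply: (lift Y) => //; apply: idealD (FP Y FY).1 _ _; right=> //.
        exact: XY.
      apply: (lift X) => //; apply: idealD (FP X FX).1 _ _; right=> //.
      exact: YX.
  - move=> s a [Ia|[X FX Xa]]; first by left; apply: idealMl.
    by apply: (lift X) => //; apply: idealMl (FP X FX).1 _; right.
have [A [[idA A1] maxA]] := Zorn_bigcup chainP.
exists (I `|` A); last exact: subsetUl.
split=> // J idJ IAJ J1 x Jx; apply: contrapT => IAx.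
have IJ : I `|` J = J.
  by apply/seteqP; split=> y; [case=> // Iy; apply: IAJ; left | right].
(* With [x] in [J] but not in [A], [J] would be a strictly larger member of [P]. *)
apply: (maxA J); last by split; rewrite IJ.
split=> [y Ay|JA]; first by apply: IAJ; right.
by apply: IAx; right; apply: JA.
Qed.

(** Distinct maximal ideals are incomparable, so each [N] in [s] has an element outside [M]. The
    product of these elements lies in every [N], and outside [M] because [M] is prime. *)
Lemma maximal_ideal_avoid M (s : seq (set S)) :
  maximal_ideal M -> (forall N, N \in s -> maximal_ideal N) -> M \notin s ->
  exists2 u, ~ M u & forall N, N \in s -> N u.
Proof.
move=> mM; elim: s => [|N s IHs] ms; first by exists 1; case: mM.
rewrite inE negb_or => /andP[/eqP MN Ms].
have ms' N' : N' \in s -> maximal_ideal N'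
  by move=> Ns; apply: ms; rewrite inE Ns orbT.
have [u Mu su] := IHs ms' Ms.
have [w Nw Mw] : exists2 w, N w & ~ M w.
  apply: contrapT => NM; apply: MN.
  have [idN N1 maxN] := ms N (mem_head _ _).
  have [idM M1 _] := mM.
  have subNM : N `<=` M by move=> w Nw; apply: contrapT => Mw; apply: NM; exists w.
  by apply/seteqP; split=> //; apply: maxN.
exists (u * w).
  by have [_ _ primeM] := maximal_ideal_prime mM; case/primeM.
move=> N'; rewrite inE => /orP[/eqP->|Ns].
  by apply: idealMl => //; case: (ms N (mem_head _ _)).
apply: idealMr; last exact: su.
by case: (ms' N' Ns).
Qed.

End IdealTheory.

Section InvertibleIdeals.
Variable S : semidomainType.
Implicit Types (I M : set S) (B : set {semifraction S}).

Lemma fractional_mul_mem (A B : set {semifraction S}) x y :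
  A x -> B y -> fractional_mul A B (x * y).
Proof.
by move=> Ax By; exists 1%N, (fun=> x), (fun=> y); rewrite big_ord1; split.
Qed.

Lemma ideal_fractional I : ideal I -> fractional_ideal (@tofrac S @` I).
Proof.
move=> idI; split.
- by have [a Ia] := ideal_neq0 idI; exists (tofrac a), a.
- by move=> _ _ [a Ia <-] [b Ib <-]; exists (a + b); [exact: idealD|rewrite rmorphD].
- by move=> s _ [a Ia <-]; exists (s * a); [exact: idealMl|rewrite rmorphM].
- exists 1; first exact: oner_neq0.
  by move=> _ [_ [a Ia <-] <-]; exists a; rewrite // rmorph1 mul1r.
Qed.

Variables (I : set S) (B : set {semifraction S}).
Hypothesis idI : ideal I.
Hypothesis fracB : fractional_ideal B.
Hypothesis IB : fractional_mul (@tofrac S @` I) B = range (@tofrac S).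

Lemma inverse_mulP a v : I a -> B v -> exists c, tofrac c = tofrac a * v.
Proof.
move=> Ia Bv; have : range (@tofrac S) (tofrac a * v).
  by rewrite -IB; apply: fractional_mul_mem => //; exists a.
by move=> [c _ cE]; exists c.
Qed.

(** The set is [v I], read inside [S] rather than among fractions. *)
Lemma inverse_mul_ideal v : B v ->
  ideal [set c | exists2 a, I a & tofrac c = tofrac a * v].
Proof.
move=> Bv; split.
- have [a Ia] := ideal_neq0 idI.
  by have [c cE] := inverse_mulP Ia Bv; exists c, a.
- move=> c d [a Ia cE] [b Ib dE].
  by exists (a + b); [exact: idealD|rewrite !rmorphD /= cE dE mulrDl].
- move=> s c [a Ia cE].
  by exists (s * a); [exact: idealMl|rewrite !rmorphM /= cE mulrA].
Qed.

(** Since [I B = S], 1 is a finite sum of products [a * b]; if all of these lay in [M], so would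
    1. *)
Lemma inverse_mul_avoid M : ideal M -> ~ M 1 ->
  exists a b c, [/\ I a, B b, tofrac c = tofrac a * b & ~ M c].
Proof.
move=> idM M1; apply: contrapT => noabc; apply: M1.
have : range (@tofrac S) 1 by exists 1; rewrite ?rmorph1.
rewrite -IB => -[n [a [b [Ia Bb sum1]]]].
have /choice[c cE] i : exists c, tofrac c = a i * b i /\ M c.
  have [x Ix xE] := Ia i; have [c cE] := inverse_mulP Ix (Bb i).
  exists c; rewrite -xE; split=> //; apply: contrapT => Mc.
  by apply: noabc; exists x, (b i), c.
have -> : 1 = \sum_(i < n) c i.
  apply: tofrac_inj; rewrite rmorph1 sum1 rmorph_sum.
  by apply: eq_bigr => i _; have [] := cE i.
by apply: ideal_sum => // i; have [] := cE i.
Qed.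

Hypothesis subS : subtractive_semiring S.

Lemma inverse_mul_avoid_seq (s : seq (set S)) :
  (forall M, M \in s -> maximal_ideal M) ->
  exists2 v, B v & forall M, M \in s ->
    exists a c, [/\ I a, tofrac c = tofrac a * v & ~ M c].
Proof.
have [B0 BD BM _] := fracB.
elim: s => [|M s IHs] ms; first by have [v Bv] := B0; exists v.
have ms' N : N \in s -> maximal_ideal N by move=> Ns; apply: ms; rewrite inE Ns orbT.
have {IHs} [v Bv sv] := IHs ms'.
have mM := ms M (mem_head _ _).
have [idM M1 _] := mM.
(* If [v I] already leaves [M], the same [v] serves. *)
have [[a [c [Ia cE Mc]]]|Mv] :=
    pselect (exists a c, [/\ I a, tofrac c = tofrac a * v & ~ M c]).
  exists v => // N; rewrite inE => /orP[/eqP->|/sv //].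
  by exists a, c.
have Ms : M \notin s by apply/negP => /sv.
have [u Mu su] := maximal_ideal_avoid mM ms' Ms.
have [a0 [b0 [c0 [Ia0 Bb0 c0E Mc0]]]] := inverse_mul_avoid idM M1.
exists (v + tofrac u * b0); first by apply: BD => //; apply: BM.
have tofracD a c d : tofrac c = tofrac a * v -> tofrac d = tofrac a * b0 ->
    tofrac (c + u * d) = tofrac a * (v + tofrac u * b0).
  by move=> cE dE; rewrite rmorphD rmorphM /= cE dE mulrDr mulrCA.
move=> N; rewrite inE => /orP[/eqP->|Ns].
  (* At [M]: [c] is in [M], so by subtractivity [c + u * c0] in [M] would put [u * c0] in the prime
     [M], though neither factor is there. *)
  have [c cE] := inverse_mulP Ia0 Bv.
  exists a0, (c + u * c0); split=> //; first exact: tofracD.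
  move=> /(@subS _ idM) Muc0.
  have Mc : M c by apply: contrapT => Mc; apply: Mv; exists a0, c.
  by have [_ _ primeM] := maximal_ideal_prime mM; have /primeM[] := Muc0 Mc.
(* At [N] in [s] the roles are exchanged: [u * d] is in [N] and [c] is not. *)
have [a [c [Ia cE Nc]]] := sv N Ns.
have [d dE] := inverse_mulP Ia Bb0.
have [idN _ _] := ms' N Ns.
exists a, (c + u * d); split=> //; first exact: tofracD.
rewrite addrC => /(@subS _ idN) Nc'.
by apply: Nc; apply: Nc'; apply: idealMr => //; apply: su.
Qed.

Lemma semilocal_invertible_principal :
  finite_set [set P : set S | prime_ideal P] -> principal I.
Proof.
move=> finP.
have : finite_set [set M : set S | maximal_ideal M].
  by apply: sub_finite_set finP => M; apply: maximal_ideal_prime.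
move=> /finite_seqP[s sE].
have ms M : M \in s <-> maximal_ideal M.
  by have -> : maximal_ideal M = [set` s] M by rewrite -sE.
have [v Bv sv] := inverse_mul_avoid_seq (fun M => (ms M).1).
have idvI := inverse_mul_ideal Bv.
(* Otherwise [v I] would be proper, hence inside a maximal ideal, and [s] lists them all. *)
have [a Ia va1] : exists2 a, I a & tofrac 1 = tofrac a * v.
  apply: contrapT => vI1; have [M mM vIM] := exists_maximal_ideal idvI vI1.
  have [a [c [Ia cE Mc]]] := sv M ((ms M).2 mM).
  by apply: Mc; apply: vIM; exists a.
exists a; rewrite smallest_ideal1; apply/seteqP; split=> [x Ix|_ [t _ <-]].
  have [c cE] := inverse_mulP Ix Bv; exists c => //.
  by apply: tofrac_inj; rewrite rmorphM /= cE mulrAC -mulrA -va1 rmorph1 mulr1.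
exact: idealMl.
Qed.

End InvertibleIdeals.

Theorem theorem3p36 (S : semidomainType) :
  subtractive_semiring S ->
  dedekind_semidomain S ->
  finite_set [set P : set S | prime_ideal P] ->
  principal_ideal_semidomain S.
Proof.
move=> subS dedS finP I idI.
(* The zero ideal has no inverse to work with; it is generated by 0. *)
have [I0|I0] := pselect (@tofrac S @` I = [set 0]).
  exists 0; rewrite smallest_ideal1; apply/seteqP; split=> [x Ix|_ [t _ <-]].
    have : [set 0] (tofrac x) by rewrite -I0; exists x.
    by rewrite -(rmorph0 (@tofrac S)) => /tofrac_inj ->; exists 0; rewrite // mulr0.
  by rewrite mulr0; apply: ideal0.
have [B [fracB IB]] := dedS _ (ideal_fractional idI) I0.
exact: (semilocal_invertible_principal idI fracB IB).
Qed.
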